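(* Let $K$ be a field and let $\mathcal{P}=kan\langle \Gamma\,|\,\Delta\,|\,RelB\,|\,M\,|\,F\rangle$ be a presentation of a left Kan extension for $K$-categories in which $\Gamma$ is the graph with one object $A$ and a collection of arrows $Q$, generating a category $\mathsf{A}$; $\Delta$ is the graph with one object $B$ and a set of arrows $X$; $RelB$ is a set $R\subseteq K[X^*]$, and $\mathsf{B}$ is the one-object $K$-category presented by $cat_K\langle\Delta\,|\,R\rangle$; $M:\mathsf{A}\to\mathsf{KMods}$ maps $A$ to $K[1]$, the one-dimensional $K$-module with basis element $1$, and every arrow of $\mathsf{A}$ to the identity; and $F$ maps the arrows of $\mathsf{A}$ to polynomials of $K[X^*]$ and induces a functor $F':\mathsf{A}\to\mathsf{B}$. Then Gröbner bases compute the left Kan extension presented by $\mathcal{P}$, in the following sense. Let $>$ be an admissible well-ordering on $X^*$, and let $\mathcal{G}$ be a Gröbner basis for the mixed system $\mathcal{S}=(S_E,S_\varepsilon)$, where $$S_E:=R,\qquad S_\varepsilon:=\{A|F(q)-A|1 : q\in Q\}.$$ Then the left Kan extension $(E,\varepsilon)$ presented by $\mathcal{P}$ is given by: (i) $E(B):=\mathtt{IRR}$, the $K$-module of all tagged polynomials $A|p$ that are irreducible with respect to $\to_{\mathcal{G}}$ (i.e. all $K$-linear combinations of the irreducible tagged words); (ii) $E(b): A|p\mapsto \mathtt{irr}(A|pb)$ for $A|p$ in $E(B)$ and $b$ in $K[X^*]$ (representing an arrow of $\mathsf{B}$); (iii) $\varepsilon_A(1):=A|1$, reduced to its irreducible form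 $\mathtt{irr}(A|1)$. Here $\mathtt{irr}(A|p)$ is the irreducible result of repeated reduction of $A|p$ by $\to_{\mathcal{G}}$.
   Context: A $K$-category is a category whose hom-sets are $K$-modules with bilinear composition; a $K$-functor is a functor preserving the $K$-module structure of hom-sets. $\mathsf{KMods}$ is the category of $K$-modules. Composites in $\mathsf{A}$, in free categories and in $\mathsf{B}$ are written left to right, so a functor $E:\mathsf{B}\to\mathsf{KMods}$ satisfies $E(b_1b_2)=E(b_2)\circ E(b_1)$. For a graph $\Delta$, $P_K\Delta$ is the free $K$-category on $\Delta$: its arrows are the $K$-linear combinations of paths with common source and common target. When $\Delta$ has one object and arrow set $X$, the arrows of $P_K\Delta$ form the free noncommutative polynomial algebra $K[X^*]$ (coefficients in $K$, terms from the free monoid $X^*$). For $R\subseteq K[X^*]$, $=_R$ is the congruence generated by $R$ ($f=_Rh$ iff $f-h$ lies in the two-sided ideal generated by $R$), and $cat_K\langle\Delta\,|\,R\rangle$ presents the $K$-category $P_K\Delta/{=_R}$, here with one object $B$ and endomorphism algebra $K[X^*]/{=_R}$. A left Kan extension presentation for $K$-categories is a quintuple $kan\langle\Gamma|\Delta|RelB|M|F\rangle$ where $\Gamma,\Delta$ are directed graphs, $M:\Gamma\to\mathsf{KMods}$ and $F:\Gamma\to P_K\Delta$ are graph morphisms, and $RelB$ is a set of relations on $P_K\Delta$. It presents the left Kan extension of the data $(M',F')$, with $M':\mathsf{A}\to\mathsf{KMods}$ and $F':\mathsf{A}\to\mathsf{B}$ functors of small categories, if $\Gamma$ is a generating graph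 for $\mathsf{A}$, $M$ is the restriction of $M'$ to $\Gamma$ (here $M'$ is again written $M$), $cat_K\langle\Delta|RelB\rangle$ is a $K$-category presentation of $\mathsf{B}$, and $F$ induces $F'$ (so here $F'(q)$ is the class of $F(q)$ modulo $=_R$). The left Kan extension of $M'$ along $F'$ is a pair $(E,\varepsilon)$ with $E:\mathsf{B}\to\mathsf{KMods}$ a $K$-functor and $\varepsilon:M'\to E\circ F'$ a natural transformation, such that for any other pair $(E',\varepsilon')$ with $E':\mathsf{B}\to\mathsf{KMods}$ a $K$-functor and $\varepsilon':M'\to E'\circ F'$ natural, there is a unique natural transformation $\alpha:E\to E'$ with $\varepsilon'=\alpha\circ\varepsilon$. Tagged polynomials: for $p\in K[X^*]$ write $A|p$ for a tagged copy of $p$, linear in $p$; these form a free right $K[X^*]$-module of rank one on $A|1$, denoted $T$, with $(A|p)b=A|pb$. A mixed system consists of a set of untagged polynomials (in $K[X^*]$) and a set of tagged polynomials (in $T$). An admissible well-ordering on $X^*$ is a well-ordering $>$ with $m>m'\Rightarrow umv>um'v$; $\mathtt{LT}(f)$ is the greatest word occurring in a nonzero polynomial $f$; tagged words $A|w$ are compared by comparing the words $w$. A polynomial is monic if it is nonzero with leading coefficient $1$. For a mixed system $\mathcal{G}$ of monic polynomials, the reduction $\to_{\mathcal{G}}$ is defined as follows: for an untagged $r\in\mathcal{G}$ and $u,v\in X^*$, a polynomial $f\in K[X^*]$ in which $u\,\mathtt{LT}(r)\,v$ occurs with coefficient $k\neq0$ reduces to $f-k\,urv$, and a tagged polynomial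 $A|f$ with the same property reduces to $A|(f-k\,urv)$; for a tagged $A|r\in\mathcal{G}$ and $v\in X^*$, a tagged polynomial $A|f$ in which $A|\mathtt{LT}(r)\,v$ occurs with coefficient $k\ne0$ reduces to $A|(f-k\,rv)$. A tagged polynomial is irreducible if no reduction applies to it. $\mathcal{G}$ is a Gröbner basis for $\mathcal{S}=(S_E,S_\varepsilon)$ if $\to_{\mathcal{G}}$ is complete (Noetherian and confluent) on untagged and on tagged polynomials, the untagged part of $\mathcal{G}$ generates the same two-sided ideal of $K[X^*]$ as $S_E$, and the untagged and tagged parts of $\mathcal{G}$ together determine the same $K$-subspace of $T$ as $\mathcal{S}$, where a mixed system with untagged part $G_E$ and tagged part $G_\varepsilon$ determines the subspace spanned by all $A|urv$ ($r\in G_E$, $u,v\in X^*$) and all $A|rv$ ($A|r\in G_\varepsilon$, $v\in X^*$). *)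

(* Defs.v *)
From HB Require Import structures.
From Stdlib Require Import Relation_Operators.
From mathcomp Require Import all_boot all_algebra.
From mathcomp Require Import mathcomp_extra boolp classical_sets wochoice.
From mathcomp.multinomials Require Import monalg.

Set Implicit Arguments.
Unset Strict Implicit.
Unset Printing Implicit Defensive.

Import GRing.Theory.
Local Open Scope ring_scope.
Local Open Scope quotient_scope.
Local Open Scope classical_set_scope.

(* Composition is in diagrammatic order in every category below, including
   that of K-modules: [ccomp f g] is f followed by g. *)
Record category := Category {
  cob :> Type;
  chom : cob -> cob -> Type;
  cid : forall a, chom a a;
  ccomp : forall a b c, chom a b -> chom b c -> chom a c;
  ccomp1l : forall a b (f : chom a b), ccomp (cid a) f = f;
  ccomp1r : forall a b (f : chom a b), ccomp f (cid b) = f;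
  ccompA : forall a b c d (f : chom a b) (g : chom b c) (h : chom c d),
    ccomp f (ccomp g h) = ccomp (ccomp f g) h
}.

Record kcategory (K : comNzRingType) := KCategory {
  kob :> Type;
  khom : kob -> kob -> lmodType K;
  kid : forall a, khom a a;
  kcomp : forall a b c, khom a b -> khom b c -> khom a c;
  kcomp1l : forall a b (f : khom a b), kcomp (kid a) f = f;
  kcomp1r : forall a b (f : khom a b), kcomp f (kid b) = f;
  kcompA : forall a b c d (f : khom a b) (g : khom b c) (h : khom c d),
    kcomp f (kcomp g h) = kcomp (kcomp f g) h;
  kcomp_linearl : forall a b c (g : khom b c),
    linear (fun f : khom a b => kcomp f g);
  kcomp_linearr : forall a b c (f : khom a b),
    linear (fun g : khom b c => kcomp f g)
}.

Definition underlying (K : comNzRingType) (C : kcategory K) : category :=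
  @Category (kob C) (fun a b => khom a b) (@kid K C) (@kcomp K C)
    (@kcomp1l K C) (@kcomp1r K C) (@kcompA K C).
Coercion underlying : kcategory >-> category.

Definition is_functor (A B : category) (F : A -> B)
    (Fh : forall a b, chom a b -> chom (F a) (F b)) : Prop :=
  (forall a, Fh a a (cid a) = cid (F a)) /\
  (forall a b c (f : chom a b) (g : chom b c),
     Fh a c (ccomp f g) = ccomp (Fh a b f) (Fh b c g)).

Record functor (A B : category) := Functor {
  fob :> A -> B;
  fhom : forall a b, chom a b -> chom (fob a) (fob b);
  functorP : is_functor fhom
}.

Definition is_kfunctor (K : comNzRingType) (B C : kcategory K) (E : B -> C)
    (Eh : forall a b : B, khom a b -> khom (E a) (E b)) : Prop :=
  @is_functor B C E Eh /\ (forall a b, linear (Eh a b)).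

Record kfunctor (K : comNzRingType) (B C : kcategory K) := KFunctor {
  kfob : B -> C;
  kfhom : forall a b : B, khom a b -> khom (kfob a) (kfob b);
  kfunctorP : is_kfunctor kfhom
}.

Definition functor_of_kfunctor (K : comNzRingType) (B C : kcategory K)
    (E : kfunctor B C) : functor B C :=
  @Functor B C (kfob E) (@kfhom K B C E) (proj1 (kfunctorP E)).
Coercion functor_of_kfunctor : kfunctor >-> functor.

Lemma functor_comp_subproof (A B C : category)
    (F : functor A B) (G : functor B C) :
  @is_functor A C (fun a => G (F a)) (fun a b f => fhom G (fhom F f)).
Proof.
case: (functorP F) (functorP G) => F1 FM [G1 GM].
by split=> [a|a b c f g]; rewrite ?F1 ?G1 ?FM ?GM.
Qed.

Definition functor_comp (A B C : category)
    (F : functor A B) (G : functor B C) : functor A C :=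
  Functor (functor_comp_subproof F G).

Lemma const_functor_subproof (A B : category) (b : B) :
  @is_functor A B (fun=> b) (fun _ _ _ => cid b).
Proof. by split=> // *; rewrite ccomp1l. Qed.

Definition const_functor (A B : category) (b : B) : functor A B :=
  Functor (const_functor_subproof A b).

Record nattrans (A B : category) (F G : functor A B) := NatTrans {
  ntmap :> forall a, chom (F a) (G a);
  naturality : forall a b (f : chom a b),
    ccomp (fhom F f) (ntmap b) = ccomp (ntmap a) (fhom G f)
}.

Definition lin (K : comNzRingType) (U V : lmodType K) := {linear U -> V}.

Section LinModule.
Context (K : comNzRingType) (U V : lmodType K).

HB.instance Definition _ := gen_eqMixin (lin U V).
HB.instance Definition _ := gen_choiceMixin (lin U V).

Lemma linP (f g : lin U V) : (f : U -> V) =1 g -> f = g.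
Proof.
case: f g => [f [[f0] [f1]]] [g [[g0] [g1]]] /= /funext efg.
move: f0 f1 g0 g1; rewrite efg => f0 f1 g0 g1.
by rewrite (Prop_irrelevance f0 g0) (Prop_irrelevance f1 g1).
Qed.

Definition lin_zero : lin U V := \0.
Definition lin_opp (f : lin U V) : lin U V := -%R \o f.
Definition lin_add (f g : lin U V) : lin U V := f \+ g.
Definition lin_scale (k : K) (f : lin U V) : lin U V := k \*: f.

Fact lin_addA : associative lin_add.
Proof. by move=> f g h; apply: linP => x /=; rewrite addrA. Qed.
Fact lin_addC : commutative lin_add.
Proof. by move=> f g; apply: linP => x /=; rewrite addrC. Qed.
Fact lin_add0 : left_id lin_zero lin_add.
Proof. by move=> f; apply: linP => x /=; rewrite add0r. Qed.
Fact lin_addN : left_inverse lin_zero lin_opp lin_add.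
Proof. by move=> f; apply: linP => x /=; rewrite addNr. Qed.
HB.instance Definition _ :=
  GRing.isZmodule.Build (lin U V) lin_addA lin_addC lin_add0 lin_addN.

Fact lin_scaleA a b f : lin_scale a (lin_scale b f) = lin_scale (a * b) f.
Proof. by apply: linP => x /=; rewrite scalerA. Qed.
Fact lin_scale1 : left_id 1 lin_scale.
Proof. by move=> f; apply: linP => x /=; rewrite scale1r. Qed.
Fact lin_scaleDr : right_distributive lin_scale +%R.
Proof. by move=> a f g; apply: linP => x /=; rewrite scalerDr. Qed.
Fact lin_scaleDl f : {morph lin_scale^~ f : a b / a + b}.
Proof. by move=> a b; apply: linP => x /=; rewrite scalerDl. Qed.
HB.instance Definition _ := GRing.Zmodule_isLmodule.Build K (lin U V)
  lin_scaleA lin_scale1 lin_scaleDr lin_scaleDl.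
End LinModule.

Section KMods.
Context (K : comNzRingType).

Definition lin_id (U : lmodType K) : lin U U := idfun.
Definition lin_comp (U V W : lmodType K) (f : lin U V) (g : lin V W) : lin U W
  := g \o f.

Fact lin_comp1l U V (f : lin U V) : lin_comp (lin_id U) f = f.
Proof. exact: linP. Qed.
Fact lin_comp1r U V (f : lin U V) : lin_comp f (lin_id V) = f.
Proof. exact: linP. Qed.
Fact lin_compA U V W Z (f : lin U V) (g : lin V W) (h : lin W Z) :
  lin_comp f (lin_comp g h) = lin_comp (lin_comp f g) h.
Proof. exact: linP. Qed.
Fact lin_comp_linearl (U V W : lmodType K) (g : lin V W) :
  linear (fun f : lin U V => lin_comp f g).
Proof. by move=> a f h; apply: linP => x /=; rewrite linearP. Qed.
Fact lin_comp_linearr (U V W : lmodType K) (f : lin U V) :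
  linear (fun g : lin V W => lin_comp f g).
Proof. by move=> a g h; apply: linP. Qed.

Definition KMods : kcategory K :=
  @KCategory K (lmodType K) (fun U V => lin U V : lmodType K)
    lin_id lin_comp lin_comp1l lin_comp1r lin_compA
    lin_comp_linearl lin_comp_linearr.
End KMods.

Definition is_left_kan_extension (K : comNzRingType) (A : category)
    (B : kcategory K) (F : functor A B) (M : functor A (KMods K))
    (E : kfunctor B (KMods K)) (eps : nattrans M (functor_comp F E)) : Prop :=
  forall (E' : kfunctor B (KMods K)) (eps' : nattrans M (functor_comp F E')),
    exists! alpha : nattrans E E',
      forall a : A, eps' a = ccomp (eps a) (alpha (F a)).

Record graph := Graph { vertex : Type; edge : vertex -> vertex -> Type }.

Definition one_vertex_graph (Q : Type) : graph :=
  @Graph unit (fun _ _ => Q).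

Record graph_map (G : graph) (A : category) := GraphMap {
  gvertex : vertex G -> A;
  gedge : forall v w : vertex G, edge v w -> chom (gvertex v) (gvertex w)
}.

Inductive generated (G : graph) (A : category) (i : graph_map G A) :
    forall a b : A, chom a b -> Prop :=
| generated_id a : generated i (cid a)
| generated_comp v w (e : edge v w) b (f : chom (gvertex i w) b) :
    generated i f -> generated i (ccomp (gedge i e) f).

(* The vertices of a generating graph are the objects of the category, up to
   renaming; every arrow is a composite of edges. *)
Definition generating (G : graph) (A : category) (i : graph_map G A) : Prop :=
  bijective (gvertex i) /\ forall a b (f : chom a b), generated i f.

Notation "u * v" := (mmul u v) : monom_scope.
Notation word X := ({fmonom X}).
Notation ncpoly K X := ({malg K[{fmonom X}]}).

Section Ideal.
Context (K : fieldType) (X : choiceType).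

Definition two_sided_ideal (I : set (ncpoly K X)) : Prop :=
  [/\ I 0, forall f g, I f -> I g -> I (f - g)
    & forall f g, I f -> I (g * f) /\ I (f * g)].

Definition ideal (R : set (ncpoly K X)) : set (ncpoly K X) :=
  smallest two_sided_ideal R.

Lemma ideal_two_sided R : two_sided_ideal (ideal R).
Proof.
split=> [I [[]]//|f g If Ig I II|f g If].
  by case: (II) => -[_ IB _] _; apply: IB; [apply: If | apply: Ig].
by split=> I II; case: (II) => -[_ _ IM] _; case: (IM f g (If _ II)).
Qed.

Definition ideal_pred (R : set (ncpoly K X)) : {pred ncpoly K X} :=
  fun f => `[< ideal R f >].

Lemma ideal_predP R f : reflect (ideal R f) (f \in ideal_pred R).
Proof. exact: asboolP. Qed.

Fact ideal_zmod_closed R : zmod_closed (ideal_pred R).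
Proof.
case: (ideal_two_sided R) => I0 IB _; split=> [|f g]; first exact/ideal_predP.
by move=> /ideal_predP If /ideal_predP Ig; apply/ideal_predP; exact: IB.
Qed.
HB.instance Definition _ R :=
  GRing.isZmodClosed.Build (ncpoly K X) (ideal_pred R) (ideal_zmod_closed R).
End Ideal.

Lemma malg_scalerAr (K : fieldType) (X : choiceType) (k : K)
    (f g : ncpoly K X) : k *: (f * g) = f * (k *: g).
Proof.
apply/malgP => w; rewrite mcoeffZ mcoeffMl.
rewrite (mcoeffMlw w (finmap.fsubset_refl (msupp f)) (msuppZ_le k g)) mulr_sumr.
apply: eq_bigr => u _; rewrite mulr_sumr; apply: eq_bigr => v _.
by rewrite mcoeffZ mulrnAr mulrCA.
Qed.

Section PresentedAlgebra.
Context (K : fieldType) (X : choiceType) (R : set (ncpoly K X)).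

(* K[X^*] / =_R; this may be the zero ring, which is why it is not made into
   an instance of the (nontrivial) algebra structures. *)
Definition presented := Quotient.quot (ideal_pred R).
HB.instance Definition _ := GRing.Zmodule.on presented.
HB.instance Definition _ := EqQuotient.on presented.

Definition cls (f : ncpoly K X) : presented := \pi_presented f.

Lemma cls_eq (f g : ncpoly K X) : cls f = cls g <-> ideal R (f - g).
Proof.
split=> [/eqP|Ifg]; first by rewrite -Quotient.idealrBE => /ideal_predP.
by apply/eqP; rewrite -Quotient.idealrBE; apply/ideal_predP.
Qed.

Lemma repr_cls (f : ncpoly K X) : ideal R (repr (cls f) - f).
Proof. by apply/cls_eq; rewrite /cls reprK. Qed.

Lemma clsK (x : presented) : cls (repr x) = x.
Proof. exact: reprK. Qed.

Lemma clsD (f g : ncpoly K X) : cls (f + g) = cls f + cls g.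
Proof. by rewrite /cls raddfD. Qed.

Definition presented_scale (k : K) (x : presented) : presented :=
  cls (k *: repr x).

Definition presented_mul (x y : presented) : presented :=
  cls (repr x * repr y).

Lemma cls_scale k (f : ncpoly K X) : presented_scale k (cls f) = cls (k *: f).
Proof.
apply/cls_eq; rewrite -scalerBr -[X in _ *: X]mul1r scalerAl.
by case: (ideal_two_sided R) => _ _ IM; case: (IM _ (k *: 1) (repr_cls f)).
Qed.

Lemma cls_mul (f g : ncpoly K X) :
  presented_mul (cls f) (cls g) = cls (f * g).
Proof.
apply/cls_eq; case: (ideal_two_sided R) => I0 IB IM.
have -> : repr (cls f) * repr (cls g) - f * g =
    (repr (cls f) - f) * repr (cls g) - f * (g - repr (cls g)).
  by rewrite mulrBl mulrBr opprB addrA subrK.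
apply: (IB); first by case: (IM _ (repr (cls g)) (repr_cls f)).
have IN : ideal R (g - repr (cls g)).
  by rewrite -opprB -sub0r; apply: (IB) => //; exact: repr_cls.
by case: (IM _ f IN).
Qed.

Fact presented_scaleA a b x :
  presented_scale a (presented_scale b x) = presented_scale (a * b) x.
Proof. by rewrite -[x]clsK !cls_scale scalerA. Qed.
Fact presented_scale1 : left_id 1 presented_scale.
Proof. by move=> x; rewrite -[x]clsK cls_scale scale1r. Qed.
Fact presented_scaleDr : right_distributive presented_scale +%R.
Proof.
move=> a x y; rewrite -[x]clsK -[y]clsK.
by rewrite -clsD !cls_scale -clsD scalerDr.
Qed.
Fact presented_scaleDl x : {morph presented_scale^~ x : a b / a + b}.
Proof.
by move=> a b /=; rewrite -[x]clsK !cls_scale -clsD scalerDl.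
Qed.
HB.instance Definition _ := GRing.Zmodule_isLmodule.Build K presented
  presented_scaleA presented_scale1 presented_scaleDr presented_scaleDl.

Lemma clsZ k (f : ncpoly K X) : cls (k *: f) = k *: cls f.
Proof. by rewrite -cls_scale. Qed.

Fact presented_mul1l x : presented_mul (cls 1) x = x.
Proof. by rewrite -[x]clsK cls_mul mul1r. Qed.
Fact presented_mul1r x : presented_mul x (cls 1) = x.
Proof. by rewrite -[x]clsK cls_mul mulr1. Qed.
Fact presented_mulA x y z :
  presented_mul x (presented_mul y z) = presented_mul (presented_mul x y) z.
Proof. by rewrite -[x]clsK -[y]clsK -[z]clsK !cls_mul mulrA. Qed.
Fact presented_mul_linearl y : linear (presented_mul^~ y).
Proof.
move=> a x z /=; rewrite -[x]clsK -[y]clsK -[z]clsK.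
by rewrite -clsZ -clsD !cls_mul -clsZ -clsD mulrDl scalerAl.
Qed.
Fact presented_mul_linearr x : linear (presented_mul x).
Proof.
move=> a y z /=; rewrite -[x]clsK -[y]clsK -[z]clsK.
by rewrite -clsZ -clsD !cls_mul -clsZ -clsD mulrDr malg_scalerAr.
Qed.

(* cat_K< Delta | R > for the graph Delta with one vertex and arrows X: words
   multiply left to right, as composites do. *)
Definition presented_kcat : kcategory K :=
  @KCategory K unit (fun _ _ => presented)
    (fun _ => cls 1) (fun _ _ _ => presented_mul)
    (fun _ _ => presented_mul1l) (fun _ _ => presented_mul1r)
    (fun _ _ _ _ => presented_mulA)
    (fun _ _ _ => presented_mul_linearl) (fun _ _ _ => presented_mul_linearr).
End PresentedAlgebra.

(* The tagged polynomial A|p is represented by p itself; [tagp] and [untagp]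
   only mark the passage between K[X^*] and the right module T. *)
Definition tpoly (K : fieldType) (X : choiceType) := ncpoly K X.
HB.instance Definition _ (K : fieldType) (X : choiceType) :=
  GRing.Lmodule.on (tpoly K X).

Definition tagp (K : fieldType) (X : choiceType) (p : ncpoly K X) : tpoly K X :=
  p.
Definition untagp (K : fieldType) (X : choiceType) (t : tpoly K X) : ncpoly K X
  := t.

Definition tact (K : fieldType) (X : choiceType) (t : tpoly K X)
  (b : ncpoly K X) : tpoly K X := tagp (untagp t * b).

(* [le] is the non-strict version of the ordering. *)
Definition admissible_well_order (X : choiceType) (le : rel (word X)) : Prop :=
  well_order le /\
  (forall u v m m' : word X, le m' m -> m' != m ->
     le (u * m' * v)%M (u * m * v)%M && ((u * m' * v)%M != (u * m * v)%M)).

Record mixed_system (K : fieldType) (X : choiceType) := MixedSystem {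
  sys_untagged : set (ncpoly K X);
  sys_tagged : set (tpoly K X)
}.

Section Reduction.
Context (K : fieldType) (X : choiceType) (le : rel (word X)).
Implicit Types (f g r : ncpoly K X) (t : tpoly K X) (u v w : word X).

Definition is_LT f w : Prop :=
  f@_w != 0 /\ (forall w', f@_w' != 0 -> le w' w).

Definition is_monic f : Prop := exists w, is_LT f w /\ f@_w = 1.

Variable G : mixed_system K X.

Definition monic_system : Prop :=
  (forall r, sys_untagged G r -> is_monic r) /\
  (forall t, sys_tagged G t -> is_monic (untagp t)).

Definition red_untagged f g : Prop :=
  exists r u v w, [/\ sys_untagged G r, is_LT r w, f@_(u * w * v)%M != 0
    & g = f - f@_(u * w * v)%M *: (<< u >> * r * << v >>)].

Definition red_tagged t t' : Prop :=
  red_untagged (untagp t) (untagp t') \/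
  exists s v w, [/\ sys_tagged G s, is_LT (untagp s) w,
    (untagp t)@_(w * v)%M != 0
    & t' = t - (untagp t)@_(w * v)%M *: tact s << v >>].

Definition irreducible t : Prop := ~ exists t', red_tagged t t'.

Definition is_irr t t' : Prop :=
  clos_refl_trans _ red_tagged t t' /\ irreducible t'.

Definition noetherian T (red : T -> T -> Prop) : Prop :=
  well_founded (fun y x => red x y).

Definition confluent T (red : T -> T -> Prop) : Prop :=
  forall x y z, clos_refl_trans T red x y -> clos_refl_trans T red x z ->
  exists2 d, clos_refl_trans T red y d & clos_refl_trans T red z d.

Definition complete T (red : T -> T -> Prop) : Prop :=
  noetherian red /\ confluent red.

Definition irr_pred : {pred tpoly K X} := fun t => `[< irreducible t >].

Lemma irreducibleP t :
  irreducible t <->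
  (forall r u v w, sys_untagged G r -> is_LT r w ->
     (untagp t)@_(u * w * v)%M = 0) /\
  (forall s v w, sys_tagged G s -> is_LT (untagp s) w ->
     (untagp t)@_(w * v)%M = 0).
Proof.
split=> [irrt|[Hu Ht] [t' [[r [u [v [w [Gr LTr +]]]]]|[s [v [w [Gs LTs +]]]]]]].
- split=> [r u v w Gr LTr|s v w Gs LTs]; apply/eqP/negPn/negP => nz.
    by apply: irrt; eexists; left; exists r, u, v, w; split; first exact: Gr.
  by apply: irrt; eexists; right; exists s, v, w; split; first exact: Gs.
- by rewrite (Hu r) ?eqxx.
- by rewrite (Ht s) ?eqxx.
Qed.

Fact irr_submod_closed : submod_closed irr_pred.
Proof.
split=> [|a t t' /asboolP/irreducibleP[Hu Ht] /asboolP/irreducibleP[Hu' Ht']].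
  by apply/asboolP/irreducibleP; split=> *; exact: mcoeff0.
apply/asboolP/irreducibleP; split=> [r u v w Gr LTr|s v w Gs LTs].
  have := Hu' r u v w Gr LTr; have := Hu r u v w Gr LTr.
  by rewrite /untagp mcoeffD mcoeffZ => -> ->; rewrite mulr0 addr0.
have := Ht' s v w Gs LTs; have := Ht s v w Gs LTs.
by rewrite /untagp mcoeffD mcoeffZ => -> ->; rewrite mulr0 addr0.
Qed.
HB.instance Definition _ :=
  GRing.isSubmodClosed.Build K (tpoly K X) irr_pred irr_submod_closed.

Record IRR := Irr { irr_val : tpoly K X; _ : irr_val \in irr_pred }.
HB.instance Definition _ := [isSub for irr_val].
HB.instance Definition _ := [Choice of IRR by <:].
HB.instance Definition _ := [SubChoice_isSubLmodule of IRR by <:].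
End Reduction.

Section Groebner.
Context (K : fieldType) (X : choiceType).
Implicit Types (G S : mixed_system K X).

Definition is_subspace (V : lmodType K) (U : set V) : Prop :=
  U 0 /\ (forall a x y, U x -> U y -> U (a *: x + y)).

Definition tagged_subspace G : set (tpoly K X) :=
  smallest (@is_subspace (tpoly K X))
    ([set t | exists r u v,
        sys_untagged G r /\ t = tagp (<< u >> * r * << v >>)] `|`
     [set t | exists s v, sys_tagged G s /\ t = tact s << v >>]).

Definition is_groebner_basis (le : rel (word X)) G S : Prop :=
  [/\ monic_system le G,
      complete (red_untagged le G),
      complete (red_tagged le G),
      ideal (sys_untagged G) = ideal (sys_untagged S)
    & tagged_subspace G = tagged_subspace S].
End Groebner.

Definition kan_system (K : fieldType) (X : choiceType) (Q : Type)
    (R : set (ncpoly K X)) (F : Q -> ncpoly K X) : mixed_system K X :=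
  MixedSystem R (range (fun q => tagp (F q) - tagp 1)).

(* Main.v *)
(* Let U be the subspace of T determined by the mixed system.  Adding a
   multiple of a generator of U to a tagged polynomial does not change the
   polynomial obtained by cancelling the leading word of that generator, so by
   confluence every element of U reduces to 0.  Hence T is the direct sum of U
   and IRR, and irr is the projection onto IRR along U; as U is a right
   submodule containing T.R, IRR is the right module T/U over K[X^*]/R.
   Modulo U the element A|1 is fixed by every F(q), and T/U is universal for
   this: a natural transformation M -> E' o F' is a vector e fixed by all the
   E'(F(q)), and it extends uniquely along A|p |-> E'(p)(e). *)
From HB Require Import structures.
Require Import Defs.
From Stdlib Require Import Relation_Operators Operators_Properties.
From mathcomp Require Import all_boot all_algebra.
From mathcomp Require Import mathcomp_extra boolp classical_sets wochoice.
From mathcomp.multinomials Require Import monalg.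

Set Implicit Arguments.
Unset Strict Implicit.
Unset Printing Implicit Defensive.

Import GRing.Theory.
Local Open Scope ring_scope.

(** * Multiplication by words and uniqueness of leading words *)

Lemma coeff_mulUl (K : fieldType) (X : choiceType) (f : ncpoly K X)
    (u w : word X) : (<< u >> * f)@_(u * w)%M = f@_w.
Proof.
rewrite mcoeffMl msuppU1 finmap.big_seq_fset1 mcoeffUU.
rewrite [in RHS](monalgE f) raddf_sum; apply: eq_bigr => k _ /=.
by rewrite mcoeffU mul1r -!val_eqE /= !fmM eqseq_cat // eqxx.
Qed.

Lemma coeff_mulUr (K : fieldType) (X : choiceType) (f : ncpoly K X)
    (v w : word X) : (f * << v >>)@_(w * v)%M = f@_w.
Proof.
rewrite mcoeffMr msuppU1 finmap.big_seq_fset1 mcoeffUU.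
rewrite [in RHS](monalgE f) raddf_sum; apply: eq_bigr => k _ /=.
rewrite mcoeffU mulr1 -!val_eqE /= !fmM; congr (_ *+ nat_of_bool _).
apply/eqP/eqP => [|-> //].
(* Right cancellation in the free monoid: reversal turns the common suffix [v] into a common
   prefix. *)
move/(congr1 rev); rewrite !rev_cat => /eqP; rewrite eqseq_cat //.
by move=> /andP[_ /eqP/(can_inj revK)].
Qed.

Lemma malgU_scale (K : fieldType) (X : choiceType) (k : K) (w : word X) :
  << k *g w >> = k *: << w >> :> ncpoly K X.
Proof. by apply/malgP => u; rewrite mcoeffZ !mcoeffU mulrnAr mulr1. Qed.

Lemma mulUU (K : fieldType) (X : choiceType) (u v : word X) :
  << u >> * << v >> = << (u * v)%M >> :> ncpoly K X.
Proof. by rewrite -[_ * _]/(fgmul _ _) fgmulUU mulr1. Qed.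

(** Each of the two words bounds the other, and a well-order is antisymmetric. *)
Lemma is_LT_inj (K : fieldType) (X : choiceType) (le : rel (word X))
    (f : ncpoly K X) (w w' : word X) :
  well_order le -> is_LT le f w -> is_LT le f w' -> w = w'.
Proof.
move=> wo [fw maxw] [fw' maxw'].
apply: (@wo_chain_antisymmetric _ le predT) => //.
  by move=> C _; apply: wo.
by rewrite maxw ?maxw'.
Qed.

(** * Closure properties of subspaces *)

Section Span.
Context (K : fieldType) (V : lmodType K).
Implicit Types (U : set V).

Lemma smallest_subspace (P : set V) :
  is_subspace (smallest (@is_subspace K V) P).
Proof.
split=> [|a x y Px Py] U [subU PU]; first by case: subU.
by case: (subU) => _; apply; [apply: Px|apply: Py].
Qed.

Variables (U : set V).
Hypothesis subU : is_subspace U.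

Lemma subspaceZ a x : U x -> U (a *: x).
Proof. by case: subU => U0 UP Ux; rewrite -[_ *: _]addr0; apply: UP. Qed.

Lemma subspaceD x y : U x -> U y -> U (x + y).
Proof. by case: subU => U0 UP Ux Uy; rewrite -[x]scale1r; apply: UP. Qed.

Lemma subspaceB x y : U x -> U y -> U (x - y).
Proof. by move=> Ux Uy; rewrite -scaleN1r addrC; case: subU => _; apply. Qed.

Lemma subspace_sum (I : Type) (r : seq I) (F : I -> V) :
  (forall i, U (F i)) -> U (\sum_(i <- r) F i).
Proof.
move=> UF; elim: r => [|j r IH]; first by rewrite big_nil; case: subU.
by rewrite big_cons; apply: subspaceD.
Qed.
End Span.

(** * The subspace of a mixed system as a right submodule *)

Section TaggedSubspace.
Context (K : fieldType) (X : choiceType) (S : mixed_system K X).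
Implicit Types (f g b : ncpoly K X) (t : tpoly K X).

Let U : set (tpoly K X) := tagged_subspace S.

Lemma tagged_subspaceP : is_subspace U.
Proof. exact: smallest_subspace. Qed.

(** By linearity [b] may be taken to be a word; the spanning set is closed under this, since the
    word is absorbed into the right factor [v] of a generator. *)
Lemma tagged_subspace_mulr f b : U f -> U (f * b).
Proof.
move=> Uf; rewrite (monalgE b) mulr_sumr.
apply: (subspace_sum tagged_subspaceP) => w.
rewrite malgU_scale -malg_scalerAr; apply: (subspaceZ tagged_subspaceP) => {b}.
suff: (tagged_subspace S `<=` [set f | U ((f : ncpoly K X) * << w >>)])%classic.
  by apply.
apply: smallest_sub.
  split=> [|a x y Ux Uy] /=; first by rewrite mul0r; case: tagged_subspaceP.
  rewrite (mulrDl (a *: (x : ncpoly K X))).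
  rewrite -(scalerAl a (x : ncpoly K X)).
  apply: (subspaceD tagged_subspaceP).
    apply: (subspaceZ tagged_subspaceP).
    exact: Ux.
  exact: Uy.
move=> _ [[r [u [v [Sr ->]]]]|[s [v [Ss ->]]]] I [subI]; apply; [left|right].
  exists r, u, (v * w)%M; split; first exact: Sr.
  by rewrite /tagp -(mulUU K v w) (mulrA _ << v >>).
exists s, (v * w)%M; split; first exact: Ss.
by rewrite /tact -mulUU mulrA.
Qed.

Lemma tagged_subspace_tagged t : sys_tagged S t -> U t.
Proof.
move=> St I [_]; apply; right; exists t, mone; split; first exact: St.
by rewrite /tact /tagp mpolyC1E mulr1.
Qed.

Lemma tagged_subspace_mulU r w : sys_untagged S r -> U (<< w >> * r).
Proof.
move=> Sr I [_]; apply; left; exists r, w, mone; split; first exact: Sr.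
by rewrite /tagp mpolyC1E mulr1.
Qed.

(** This makes the quotient of T by [U] a module over the presented algebra. Since [g] is arbitrary,
    the polynomials [f] with this property form a two-sided ideal, so only elements of the untagged
    part need checking. *)
Lemma tagged_subspace_ideal f g : ideal (sys_untagged S) f -> U (g * f).
Proof.
move: f g; suff: (ideal (sys_untagged S) `<=`
    [set f | forall g, U (g * f)])%classic by move=> sub f g /sub.
apply: smallest_sub => [|r Sr g /=].
  split=> [g|f1 f2 U1 U2 g|f1 f2 U1] /=.
  - by rewrite mulr0; case: tagged_subspaceP.
  - by rewrite mulrBr; apply: (subspaceB tagged_subspaceP);
      [apply: U1|apply: U2].
  - split=> h; rewrite mulrA; first exact: U1.
    exact: (tagged_subspace_mulr f2 (U1 h)).
rewrite (monalgE g) mulr_suml; apply: (subspace_sum tagged_subspaceP) => w.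
rewrite malgU_scale -scalerAl; apply: (subspaceZ tagged_subspaceP).
exact: tagged_subspace_mulU.
Qed.
End TaggedSubspace.

(** * Normal forms as a projection along the subspace *)

Section NormalForm.
Context (K : fieldType) (X : choiceType) (le : rel (word X)).
Context (G : mixed_system K X).
Hypotheses (wo_le : well_order le) (monicG : monic_system le G).
Hypothesis completeG : complete (red_tagged le G).
Implicit Types (t p : tpoly K X) (w : word X).

Local Notation "t ->* t'" :=
  (clos_refl_trans (tpoly K X) (red_tagged le G) t t') (at level 70).

Let U : set (tpoly K X) := tagged_subspace G.
Let subU : is_subspace U := tagged_subspaceP G.

Lemma monic_LT (f : ncpoly K X) w : is_monic le f -> is_LT le f w -> f@_w = 1.
Proof. by move=> [w' [LT' <-]] LT; rewrite (is_LT_inj wo_le LT LT'). Qed.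

(** Treats both kinds of step alike: [p] is the polynomial whose multiple gets subtracted, and [w]
    is the word cancelled by it. *)
Definition reducer p w : Prop :=
  (exists r u v w0, [/\ sys_untagged G r, is_LT le r w0, w = (u * w0 * v)%M
     & p = << u >> * r * << v >>]) \/
  (exists s v w0, [/\ sys_tagged G s, is_LT le (untagp s) w0, w = (w0 * v)%M
     & p = tact s << v >>]).

Lemma red_taggedE t t' : red_tagged le G t t' <->
  exists p w, [/\ reducer p w, (untagp t)@_w != 0
    & t' = t - (untagp t)@_w *: p].
Proof.
split=> [[[r [u [v [w [Gr LTr nz e]]]]]|[s [v [w [Gs LTs nz e]]]]]|].
- exists (<< u >> * r * << v >>), (u * w * v)%M; split=> //.
  by left; exists r, u, v, w.
- by exists (tact s << v >>), (w * v)%M; split=> //; right; exists s, v, w.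
move=> [p [w [red nz e]]].
case: red => [[r [u [v [w0 [Gr LTr ew ep]]]]]|[s [v [w0 [Gs LTs ew ep]]]]].
  left; exists r, u, v, w0; rewrite -ew -ep.
  by split; [exact: Gr|exact: LTr|exact: nz|exact: e].
right; exists s, v, w0; rewrite -ew -ep.
by split; [exact: Gs|exact: LTs|exact: nz|exact: e].
Qed.

(** Multiplying by words only translates coefficients, so this is the leading coefficient of a monic
    element. *)
Lemma reducer_coeff p w : reducer p w -> (untagp p)@_w = 1.
Proof.
case: monicG => monU monT.
move=> [[r [u [v [w0 [Gr LTr -> ->]]]]]|[s [v [w0 [Gs LTs -> ->]]]]].
  by rewrite /untagp coeff_mulUr coeff_mulUl (monic_LT (monU _ Gr)).
by rewrite /untagp coeff_mulUr (monic_LT (monT _ Gs)).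
Qed.

Lemma reducer_subspace p w : reducer p w -> U p.
Proof.
move=> [[r [u [v [w0 [Gr _ _ ->]]]]]|[s [v [w0 [Gs _ _ ->]]]]].
  exact: (tagged_subspace_mulr _ (tagged_subspace_mulU u Gr)).
exact: (tagged_subspace_mulr _ (tagged_subspace_tagged Gs)).
Qed.

Lemma red_subspace t t' : t ->* t' -> U (t - t').
Proof.
elim=> [x y /red_taggedE[p [w [red _ ->]]]|x|x y z _ Uxy _ Uyz].
- rewrite opprB addrC subrK; apply: (subspaceZ subU).
  exact: reducer_subspace red.
- by rewrite subrr; case: subU.
- by rewrite -(subrKA y x (- z)); apply: (subspaceD subU).
Qed.

Definition joinable t t' : Prop := exists2 z, t ->* z & t' ->* z.

(** The two meeting points are both reducts of [t2], so confluence joins them. *)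
Lemma joinable_trans t1 t2 t3 :
  joinable t1 t2 -> joinable t2 t3 -> joinable t1 t3.
Proof.
move=> [x x1 x2] [y y2 y3]; case: completeG => _ /(_ _ _ _ x2 y2)[d xd yd].
by exists d; [apply: rt_trans xd|apply: rt_trans yd].
Qed.

(* Subtracting the multiple of [p] that cancels the word [w] is a reduction
   step, or no step at all; applied to [t + c *: p] and to [t], it gives the
   same polynomial. *)
Lemma joinable_reducer p w c t : reducer p w -> joinable (t + c *: p) t.
Proof.
move=> red.
have clear s : s ->* s - (untagp s)@_w *: p.
  have [e|nz] := eqVneq (untagp s)@_w 0.
    by rewrite e scale0r subr0; apply: rt_refl.
  by apply: rt_step; apply/red_taggedE; exists p, w.
exists (t - (untagp t)@_w *: p); last exact: clear.
have := clear (t + c *: p).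
rewrite [untagp (t + _)]/(untagp t + c *: untagp p) mcoeffD mcoeffZ.
by rewrite (reducer_coeff red) mulr1 scalerDl [_ *: p + _]addrC addrKA.
Qed.

(** Quantifying over [c] and [s] makes the property stable under linear combinations, which can be
    added to [s] one summand at a time; generators are covered by [joinable_reducer]. *)
Lemma joinable_subspace t : U t -> forall c s, joinable (s + c *: t) s.
Proof.
suff: (tagged_subspace G `<=`
       [set t : tpoly K X | forall c s, joinable (s + c *: t) s])%classic.
  by move=> sub /sub.
apply: smallest_sub => [|p].
  split=> [c s|a x y Ux Uy c s] /=.
    by rewrite scaler0 addr0; exists s; apply: rt_refl.
  rewrite scalerDr scalerA addrA.
  exact: joinable_trans (Uy _ _) (Ux _ _).
case: monicG => monU monT.
move=> [[r [u [v [Gr ->]]]]|[s [v [Gs ->]]]] c t'.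
  have [w [LTr _]] := monU _ Gr.
  by apply: (@joinable_reducer _ (u * w * v)%M); left; exists r, u, v, w.
have [w [LTs _]] := monT _ Gs.
by apply: (@joinable_reducer _ (w * v)%M); right; exists s, v, w.
Qed.

Lemma irreducible_red t t' : irreducible le G t -> t ->* t' -> t' = t.
Proof.
move=> irrt red; have {red} := clos_rt_rt1n _ _ _ _ red.
by case=> // y z step _; case: irrt; exists y.
Qed.

(** Such a [t] is joinable with 0, and neither of the two can be reduced further. *)
Lemma irreducible_subspace t : irreducible le G t -> U t -> t = 0.
Proof.
move=> irrt /joinable_subspace/(_ 1 0)[z]; rewrite add0r scale1r.
move=> /(irreducible_red irrt) -> /irreducible_red e; apply: e.
by apply/asboolP; apply: (rpred0 (irr_pred le G)).
Qed.

Lemma exists_irr t : exists t', is_irr le G t t'.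
Proof.
case: completeG => wf _; elim: {t}(wf t) => t _ IH.
have [[t' step]|irrt] := pselect (exists t', red_tagged le G t t').
  have [t'' [red irr]] := IH _ step.
  by exists t''; split=> //; apply: rt_trans red; apply: rt_step.
by exists t; split=> //; apply: rt_refl.
Qed.

Lemma exists_nf t : exists n : IRR le G, is_irr le G t (irr_val n).
Proof.
have [t' irr] := exists_irr t.
have irrt' : t' \in irr_pred le G by apply/asboolP; case: irr.
by exists (Irr irrt').
Qed.

(** Here [cid] is the choice operator of [boolp], not an identity arrow; [nf_unique] shows that the
    result does not depend on the choice. *)
Definition nf t : IRR le G := projT1 (cid (exists_nf t)).

Lemma nf_irr t : is_irr le G t (irr_val (nf t)).
Proof. by rewrite /nf; case: boolp.cid. Qed.

Lemma nf_subspace t : U (t - irr_val (nf t)).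
Proof. by apply: red_subspace; case: (nf_irr t). Qed.

Lemma irr_valB_subspace (m n : IRR le G) : U (irr_val m - irr_val n) -> m = n.
Proof.
move=> Umn; apply: val_inj; apply/eqP; rewrite -subr_eq0; apply/eqP.
apply: irreducible_subspace Umn; apply/asboolP.
exact: (valP (m - n)).
Qed.

(** Congruence modulo [U] thus determines the normal form, so later identities between normal forms
    need no reduction sequences. *)
Lemma nf_unique t (n : IRR le G) : U (t - irr_val n) -> nf t = n.
Proof.
move=> Utn; apply: irr_valB_subspace.
have -> : irr_val (nf t) - irr_val n = t - irr_val n - (t - irr_val (nf t)).
  by rewrite opprB [RHS]addrC subrKA.
by apply: (subspaceB subU) Utn (nf_subspace t).
Qed.

Lemma nf_eq t t' : U (t - t') -> nf t = nf t'.
Proof.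
move=> Utt'; apply: nf_unique; rewrite -(subrKA t' t).
exact: (subspaceD subU) Utt' (nf_subspace t').
Qed.

Lemma nf_val (n : IRR le G) : nf (irr_val n) = n.
Proof. by apply: nf_unique; rewrite subrr; case: subU. Qed.

Lemma nf_linear : linear nf.
Proof.
move=> a t t'; apply: nf_unique.
rewrite -[irr_val _]/(a *: irr_val (nf t) + irr_val (nf t')).
rewrite opprD addrACA -scalerBr.
by case: subU => _; apply; apply: nf_subspace.
Qed.
End NormalForm.

(** * Linear maps, natural transformations and one-object categories *)

Definition linear_of (K : comNzRingType) (U V : lmodType K) (f : U -> V)
    (lf : linear f) : {linear U -> V} :=
  HB.pack f (GRing.isLinear.Build K U V _ f lf).

Lemma nattransP (A B : category) (F G : functor A B) (s t : nattrans F G) :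
  (forall a, s a = t a) -> s = t.
Proof.
case: s t => [s sn] [t tn] /= st.
have {}st : s = t by apply: functional_extensionality_dep.
by rewrite st in sn *; rewrite (Prop_irrelevance sn tn).
Qed.

Lemma one_object_eq (Q : Type) (A : category)
    (i : graph_map (one_vertex_graph Q) A) :
  generating i -> forall a, a = gvertex i tt.
Proof. by move=> [[g _ gK] _] a; rewrite -{1}(gK a); case: (g a). Qed.

(** * The functor on [IRR] and the unit *)

Section KanExtension.
Context (K : fieldType) (Q : Type) (X : choiceType) (R : set (ncpoly K X)).
Context (A : category) (i : graph_map (one_vertex_graph Q) A).
Context (F : Q -> ncpoly K X) (F' : functor A (presented_kcat R)).
Context (le : rel (word X)) (G : mixed_system K X).
Hypothesis genA : generating i.
Hypothesis F'E : forall q : Q, fhom F' (@gedge _ _ i tt tt q) = cls R (F q).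
Hypotheses (wo_le : well_order le) (monicG : monic_system le G).
Hypothesis completeG : complete (red_tagged le G).
Hypothesis spanG : tagged_subspace G = tagged_subspace (kan_system R F).

Let M := @const_functor A (KMods K) (K^o : lmodType K).
Let a0 : A := gvertex i tt.
Let nf := nf completeG.

Lemma nf_kan (t t' : tpoly K X) :
  tagged_subspace (kan_system R F) (t - t') -> nf t = nf t'.
Proof. by rewrite -spanG; apply: nf_eq. Qed.

Definition nf_mul (x : presented R) (n : IRR le G) : IRR le G :=
  nf (tact (irr_val n) (repr x)).

(** Two representatives of a class differ by an element of the ideal, which multiplies T into the
    subspace. *)
Lemma nf_mul_cls b n : nf_mul (cls R b) n = nf (tact (irr_val n) b).
Proof.
apply: nf_kan; rewrite /tact /tagp /untagp -mulrBr.
exact: (@tagged_subspace_ideal _ _ (kan_system R F) _ _ (@repr_cls K X R b)).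
Qed.

(** Reducing before multiplying changes the product by an element of the right submodule. *)
Lemma nf_mul_nf (x : presented R) t : nf_mul x (nf t) = nf (tact t (repr x)).
Proof.
apply: nf_kan; rewrite /tact /tagp /untagp -mulrBl -spanG.
apply: tagged_subspace_mulr; rewrite -opprB -sub0r.
apply: (subspaceB (tagged_subspaceP G)); first by case: (tagged_subspaceP G).
exact: nf_subspace.
Qed.

Lemma nf_mul_linear x : linear (nf_mul x).
Proof.
move=> a m n; rewrite -nf_linear //; congr nf.
rewrite /tact /tagp /untagp.
rewrite -[irr_val _]/(a *: (irr_val m : ncpoly K X) + irr_val n).
by rewrite mulrDl -scalerAl.
Qed.

Definition act x : {linear IRR le G -> IRR le G} := linear_of (nf_mul_linear x).

Lemma act_cls_nf b t : act (cls R b) (nf t) = nf (tact t b).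
Proof.
rewrite -[LHS]/(nf_mul _ _) nf_mul_nf.
apply: nf_kan; rewrite /tact /tagp /untagp -mulrBr.
exact: (@tagged_subspace_ideal _ _ (kan_system R F) _ _ (@repr_cls K X R b)).
Qed.

Lemma act_kfunctor : @is_kfunctor K (presented_kcat R) (KMods K)
  (fun=> IRR le G : lmodType K) (fun _ _ => act).
Proof.
split; first split=> [a|a b c x y].
- apply: linP => n; rewrite -[LHS]/(nf_mul (cls R 1) n) nf_mul_cls.
  by rewrite /tact /tagp /untagp mulr1; apply: nf_val.
- rewrite -[x]clsK -[y]clsK; apply: linP => n.
  rewrite -[n](nf_val wo_le monicG completeG).
  rewrite -[ccomp _ _ in LHS]/(presented_mul (cls R (repr x)) (cls R (repr y))).
  rewrite cls_mul act_cls_nf.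
  rewrite -[RHS]/(act (cls R (repr y)) (act (cls R (repr x)) (nf (irr_val n)))).
  by rewrite !act_cls_nf /tact /tagp /untagp mulrA.
move=> b c a x y; apply: linP => n.
rewrite -[LHS]/(nf_mul (a *: x + y) n) -[RHS]/(a *: nf_mul x n + nf_mul y n).
rewrite -[x]clsK -[y]clsK -clsZ -clsD !nf_mul_cls -nf_linear //.
congr nf; rewrite /tact /tagp /untagp.
by rewrite mulrDr -malg_scalerAr.
Qed.

Let E := KFunctor act_kfunctor.

(** Induction on [f] as a composite of edges: putting an edge [q] in front changes A|r into A|F(q)r,
    and the difference is a tagged relation multiplied by r. *)
Lemma act_arrow a b (f : chom a b) :
  act (fhom F' f) (nf (tagp 1)) = nf (tagp 1).
Proof.
case: genA => _ /(_ _ _ f); elim=> {a b f} [a|v w q b f _ IH].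
  case: (functorP F') => -> _; rewrite -[Defs.cid _]/(cls R 1) act_cls_nf.
  by rewrite /tact /tagp /untagp mulr1.
case: (functorP F') => _ ->; case: v w q f IH => -[] q f IH.
rewrite F'E -[ccomp _ _]/(presented_mul (cls R (F q)) (fhom F' f)).
(* The induction hypothesis is used backwards, so that both sides carry the same tail, a
   representative of [fhom F' f]. *)
rewrite -[RHS]IH -[fhom F' f]clsK cls_mul !act_cls_nf.
apply: nf_kan; set r := repr _.
have -> : tact (tagp 1) (F q * r) - tact (tagp 1) r =
    (F q - 1) * r :> ncpoly K X.
  by rewrite /tact /tagp /untagp !mul1r mulrBl mul1r.
apply: tagged_subspace_mulr; apply: tagged_subspace_tagged.
by exists q.
Qed.

Fact unit_linear : linear (fun k : K^o => (k : K) *: nf (tagp 1)).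
Proof. by move=> a k l; rewrite scalerA -scalerDl. Qed.

Definition unit_map : {linear K^o -> IRR le G} := linear_of unit_linear.

Lemma unit_mapE (k : K) : unit_map k = k *: nf (tagp 1).
Proof. by []. Qed.

(** As [M] sends every arrow to the identity, naturality is the invariance given by [act_arrow]. *)
Lemma unit_natural a b (f : chom a b) :
  ccomp (fhom M f) (unit_map : chom (M b) (E (F' b))) =
  ccomp (unit_map : chom (M a) (E (F' a))) (fhom (functor_comp F' E) f).
Proof.
apply: linP => k.
rewrite -[LHS]/(unit_map k) -[RHS]/(act (fhom F' f) (unit_map k)).
by rewrite unit_mapE linearZ act_arrow.
Qed.

Definition eps : nattrans M (functor_comp F' E) :=
  @NatTrans A (KMods K) M (functor_comp F' E) (fun=> unit_map) unit_natural.

(** * The universal property *)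

Section Factorization.
Variables (E' : kfunctor (presented_kcat R) (KMods K)).
Variable eps' : nattrans M (functor_comp F' E').

Let V (b : unit) : lmodType K := kfob E' b.

(** The objects remain variables because [fob F' a0] is not convertible to [tt]. *)
Definition arr (b c : unit) (x : presented R) : {linear V b -> V c} :=
  @kfhom K (presented_kcat R) (KMods K) E' b c x.

Lemma arr1 b u : arr b b (cls R 1) u = u.
Proof.
case: (kfunctorP E') => -[E'1 _] _.
exact: (congr1 (fun h : lin (V b) (V b) => h u) (E'1 b)).
Qed.

Lemma arrM b c d x y u :
  arr b d (presented_mul x y) u = arr c d y (arr b c x u).
Proof.
case: (kfunctorP E') => -[_ E'M] _.
exact: (congr1 (fun h : lin (V b) (V d) => h u) (E'M b c d x y)).
Qed.

Lemma arr_linear b c u : linear (fun x => arr b c x u).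
Proof.
case: (kfunctorP E') => _ E'L a x y.
exact: (congr1 (fun h : lin (V b) (V c) => h u) (E'L b c a x y)).
Qed.

Let e : V (fob F' a0) := (eps' a0 : {linear K^o -> V (fob F' a0)}) 1.

Definition eval b (t : tpoly K X) : V b := arr (fob F' a0) b (cls R t) e.

Lemma eval_linear b : linear (eval b).
Proof. by move=> a t t'; rewrite /eval clsD clsZ arr_linear. Qed.

Lemma evalB b t t' : eval b (t - t') = eval b t - eval b t'.
Proof. exact: (linearB (linear_of (eval_linear b))). Qed.

Lemma evalM b c (t f : ncpoly K X) :
  eval c (t * f) = arr b c (cls R f) (eval b t).
Proof. by rewrite /eval -cls_mul (arrM b). Qed.

(** Hence [eval] descends to the quotient of T: untagged generators already vanish in the presented
    algebra, and tagged ones vanish by naturality of [eps']. *)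
Lemma eval_kan b t : tagged_subspace (kan_system R F) t -> eval b t = 0.
Proof.
suff: (tagged_subspace (kan_system R F) `<=`
    [set t | forall b, eval b t = 0])%classic by move=> sub /sub.
have eval0 c : eval c 0 = 0 by exact: (linear0 (linear_of (eval_linear c))).
apply: smallest_sub.
  split=> [|a x y /= x0 y0] c; first exact: eval0.
  by rewrite eval_linear x0 y0 scaler0 addr0.
move=> _ [[r [u [v [Rr ->]]]]|[_ [v [[q _ <-] ->]]]] c.
  rewrite -(eval0 c) /eval; congr (arr _ _ _ e).
  apply/cls_eq; rewrite subr0.
  case: (ideal_two_sided R) => _ _ IM.
  apply: (proj2 (IM _ _ _)); apply: (proj1 (IM _ _ _)).
  by move=> I [_]; apply.
(* Applied to 1, naturality at the edge [q] says that the class of [F q] fixes [e]. *)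
have nat := naturality eps' (@gedge _ _ i tt tt q).
have {nat} := congr1 (fun h : lin (K^o : lmodType K) (V _) => h 1) nat.
rewrite -[LHS]/e -[RHS]/(arr (fob F' a0) (fob F' a0)
  (fhom F' (@gedge _ _ i tt tt q)) e) F'E => eF.
rewrite (evalM (fob F' a0)) evalB.
rewrite {1}/eval -eF /eval arr1 subrr.
exact: (linear0 (arr _ _ _)).
Qed.

Lemma eval_nf b t : eval b (irr_val (nf t)) = eval b t.
Proof.
apply/esym/eqP; rewrite -subr_eq0 -evalB; apply/eqP/eval_kan.
by rewrite -spanG; apply: nf_subspace.
Qed.

Lemma eval_irr_linear b : linear (fun n : IRR le G => eval b (irr_val n)).
Proof. by move=> a m n; rewrite -eval_linear. Qed.

Definition factor_map b : {linear IRR le G -> V b} :=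
  linear_of (eval_irr_linear b).

Lemma factor_natural b c (x : presented R) :
  @ccomp (KMods K) _ _ _ (fhom E x) (factor_map c : chom (E b) (E' c)) =
  ccomp (factor_map b : chom (E b) (E' b))
    (fhom E' (x : @chom (presented_kcat R) b c)).
Proof.
apply: linP => n.
rewrite -[LHS]/(eval c (irr_val (nf (tact (irr_val n) (repr x))))).
by rewrite eval_nf /tact /tagp /untagp (evalM b) clsK.
Qed.

Definition factor : nattrans E E' :=
  @NatTrans (presented_kcat R) (KMods K) E E' factor_map factor_natural.

Lemma factorP a : eps' a = ccomp (eps a) (factor (F' a)).
Proof.
rewrite (one_object_eq genA a); apply: linP => k.
rewrite -[LHS]/((eps' a0 : {linear K^o -> V (fob F' a0)}) k).
rewrite -[RHS]/(factor_map (fob F' a0) (unit_map k)).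
(* Both sides are linear in [k], so they are compared at 1. *)
rewrite unit_mapE linearZ -[k in LHS]mulr1.
rewrite -[(k * 1)%R]/(k *: (1 : K^o)) linearZ; congr (_ *: _).
by rewrite -[RHS]/(eval _ (irr_val (nf _))) eval_nf /eval arr1.
Qed.

(** The normal form of A|1 generates [IRR]: acting on it by the class of [n] gives [n]. Naturality
    then determines [alpha] from its value there, which must be [e]. *)
Lemma factor_unique (alpha : nattrans E E') :
  (forall a, eps' a = ccomp (eps a) (alpha (F' a))) -> factor = alpha.
Proof.
move=> alphaP; apply: nattransP => b; apply: linP => n.
pose al c : {linear IRR le G -> V c} := alpha c.
have e1 : e = al (fob F' a0) (nf (tagp 1)).
  rewrite /e (alphaP a0) -[LHS]/(al (fob F' a0) (unit_map 1)).
  by rewrite unit_mapE scale1r.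
rewrite -[LHS]/(eval b (irr_val n)) /eval e1.
have nat := naturality alpha
  (cls R (irr_val n) : @chom (presented_kcat R) (fob F' a0) b).
have {nat} := congr1 (fun h : lin (IRR le G) (V b) => h (nf (tagp 1))) nat.
rewrite -[RHS]/(arr (fob F' a0) b (cls R (irr_val n)) _) => <-.
rewrite -[LHS]/(al b (act (cls R (irr_val n)) (nf (tagp 1)))).
by rewrite act_cls_nf /tact /tagp /untagp mul1r /nf nf_val.
Qed.
End Factorization.

Lemma eps_kan : is_left_kan_extension eps.
Proof.
move=> E' eps'; exists (factor eps'); split; first exact: factorP.
exact: factor_unique.
Qed.
End KanExtension.

Theorem corollary4p3 (K : fieldType) (Q : Type) (X : choiceType)
    (R : set (ncpoly K X))
    (A : category) (i : graph_map (one_vertex_graph Q) A)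
    (F : Q -> ncpoly K X) (F' : functor A (presented_kcat R))
    (le : rel (word X)) (G : mixed_system K X) :
  generating i ->
  (forall q : Q, fhom F' (@gedge _ _ i tt tt q) = cls R (F q)) ->
  admissible_well_order le ->
  is_groebner_basis le G (kan_system R F) ->
  let M := @const_functor A (KMods K) (K^o : lmodType K) in
  exists (act : presented R -> {linear IRR le G -> IRR le G})
         (actP : @is_kfunctor K (presented_kcat R) (KMods K)
                   (fun=> IRR le G : lmodType K) (fun _ _ => act)),
  let E := KFunctor actP in
  exists eps : nattrans M (functor_comp F' E),
    [/\ forall (p : IRR le G) (b : ncpoly K X),
          is_irr le G (tact (irr_val p) b) (irr_val (act (cls R b) p)),
        is_irr le G (tagp 1) 
          (irr_val ((eps (gvertex i tt) : {linear K^o -> IRR le G}) 1))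
      & is_left_kan_extension eps].
Proof.
move=> genA F'E [wo_le _] [monicG _ completeG _ spanG] M.
exists (@act _ _ R _ _ wo_le monicG completeG).
exists (act_kfunctor wo_le monicG completeG spanG) => E.
exists (eps genA F'E wo_le monicG completeG spanG); split.
- move=> p b; have := nf_irr completeG (tact (irr_val p) b).
  (* The action uses a chosen representative of the class of [b]; this replaces it by [b] itself. *)
  by rewrite -(nf_mul_cls wo_le monicG completeG spanG).
- rewrite -[X in irr_val X]/(unit_map completeG 1).
  by rewrite unit_mapE scale1r; apply: nf_irr.
- exact: eps_kan.
Qed.
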